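(* For every irrational real number $\theta$ one has $$\omega(\theta)\ \ge\ \frac{1}{2-\overline{\omega}(\theta)};$$ in particular, $\omega(\theta)=+\infty$ when $\overline{\omega}(\theta)=2$.
   Context: $\|x\|$ denotes the distance from the real number $x$ to the nearest integer, and $\mathbb{Z}_+$ is the set of positive integers. For an irrational real number $\theta$ and real $t\ge 1$ define $$\psi_\theta(t)=\min_{q\in\mathbb{Z}_+:\,q\le t}\|q\theta\|,\qquad \upsilon_\theta(t)=\min_{q\in\mathbb{Z}_+:\,q\le t} q\cdot\|q\theta\|.$$ The ordinary Diophantine exponent of $\theta$ is $$\omega(\theta)=\sup\{\gamma\in\mathbb{R}:\ \liminf_{t\to\infty}t^{\gamma}\psi_\theta(t)<\infty\}\in[1,+\infty].$$ The weak uniform Diophantine exponent of $\theta$ is $$\overline{\omega}(\theta)=\sup\{\gamma\in\mathbb{R}:\ \limsup_{t\to\infty}t^{\gamma-1}\upsilon_\theta(t)<\infty\}.$$ It is known that $1\le\overline{\omega}(\theta)\le 2$ for every irrational $\theta$. When $\overline{\omega}(\theta)=2$ the right-hand side $1/(2-\overline{\omega}(\theta))$ is interpreted as $+\infty$. *)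

(* Defs.v *)
From HB Require Import structures.
From mathcomp Require Import all_boot all_order all_algebra.
From mathcomp Require Import all_classical all_reals all_analysis.

Set Implicit Arguments.
Unset Strict Implicit.
Unset Printing Implicit Defensive.

Import Order.TTheory GRing.Theory Num.Theory.
Import numFieldNormedType.Exports.

Local Open Scope classical_set_scope.
Local Open Scope ring_scope.

(** [distZ x] is $\|x\|$.  The infimum is attained (see [distZ_attained]). *)
Definition distZ (R : realType) (x : R) : R :=
  inf [set `|x - n%:~R| | n in [set: int]].

Definition posnat_le (R : realType) (t : R) : set nat :=
  [set q | (0 < q)%N /\ q%:R <= t].

(** For [1 <= t] the index set is finite and nonempty, so both infima are
    minima (see [psi_min] and [upsilon_min]).  For [t < 1] the index set is
    empty and the value is the junk [inf set0 = 0]; only the behaviour at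
    [+oo] is used. *)
Definition psi (R : realType) (theta t : R) : R :=
  inf [set distZ (q%:R * theta) | q in posnat_le t].

Definition upsilon (R : realType) (theta t : R) : R :=
  inf [set q%:R * distZ (q%:R * theta) | q in posnat_le t].

(** Both suprema are taken in [\bar R], whose inverse satisfies
    [0^-1 = +oo]: hence [(2%:E - weak_omega theta)^-1] is [+oo] when
    [weak_omega theta = 2%:E]. *)
Definition omega (R : realType) (theta : R) : \bar R :=
  ereal_sup [set gamma%:E | gamma in
    [set gamma : R |
      (limf_einf (fun t : R => (t `^ gamma * psi theta t)%:E) (pinfty_nbhs R)
        < +oo)%E]].

Definition weak_omega (R : realType) (theta : R) : \bar R :=
  ereal_sup [set gamma%:E | gamma in
    [set gamma : R |
      (limf_esup (fun t : R => (t `^ (gamma - 1) * upsilon theta t)%:E)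
         (pinfty_nbhs R)
        < +oo)%E]].

Lemma distZ_attained (R : realType) (x : R) :
  exists n : int, distZ x = `|x - n%:~R| /\
    forall m : int, `|x - n%:~R| <= `|x - m%:~R|.
Proof.
have [n nP] : exists n : int, forall m : int, `|x - n%:~R| <= `|x - m%:~R|.
  pose f := Num.floor x.
  have fx : f%:~R <= x by exact: Num.Theory.floor_le.
  have xf : x < (f + 1)%:~R by exact: Num.Theory.floorD1_gt.
  have main m : Num.min `|x - f%:~R| `|x - (f + 1)%:~R| <= `|x - m%:~R|.
    rewrite ge_min; have [mf|fm] := lerP m f.
      apply/orP; left; rewrite !ger0_norm ?subr_ge0 //.
        by rewrite lerB// ler_int.
      by rewrite (le_trans _ fx)// ler_int.
    have fm1 : f + 1 <= m by rewrite lezD1.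
    apply/orP; right; rewrite distrC (distrC x) !ger0_norm ?subr_ge0 ?(ltW xf) //.
      by rewrite lerB// ler_int.
    by rewrite (le_trans (ltW xf))// ler_int.
  have [h|h] := leP `|x - f%:~R| `|x - (f + 1)%:~R|.
    by exists f => m; move: (main m); rewrite (min_idPl h).
  by exists (f + 1) => m; move: (main m); rewrite (min_idPr (ltW h)).
exists n; split=> //; apply/le_anti/andP; split.
  by apply: ge_inf; [exists 0 => _ [m _ <-]| exists n].
by apply: lb_le_inf; [exists `|x - n%:~R|, n|move=> _ [m _ <-]].
Qed.

Lemma inf_posnat_le_min (R : realType) (F : nat -> R) (t : R) : 1 <= t ->
  exists q, [/\ posnat_le t q, inf [set F q | q in posnat_le t] = F q &
    forall p, posnat_le t p -> F q <= F p].
Proof.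
move=> t1; have t0 : 0 <= t by exact: le_trans t1.
pose N := Num.truncn t.
have posE q : posnat_le t q <-> (0 < q <= N)%N.
  by rewrite /posnat_le /= truncn_ge_nat//; split=> [[-> ->]|/andP[]].
have N0 : (0 < N)%N by rewrite truncn_ge_nat.
have N1 : (0 < Ordinal (N0 : 1 < N.+1))%N by [].
case: (@Order.TotalTheory.arg_minP _ _ _ _ (fun i : 'I_N.+1 => (0 < i)%N)
  (fun i => F i) N1) => i i0 iP.
have iN : posnat_le t i by apply/posE; rewrite i0 -ltnS ltn_ord.
have min p : posnat_le t p -> F i <= F p.
  by move=> /posE /andP[p0]; rewrite -ltnS => pN; exact: (iP (Ordinal pN)).
exists (i : nat); split=> //; apply/le_anti/andP; split.
  by apply: ge_inf; [exists (F i) => _ [p /min ? <-]|exists (i : nat)].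
by apply: lb_le_inf; [exists (F i), (i : nat)|move=> _ [p /min ? <-]].
Qed.

Lemma psi_min (R : realType) (theta t : R) : 1 <= t ->
  exists q, [/\ posnat_le t q, psi theta t = distZ (q%:R * theta) &
    forall p, posnat_le t p -> distZ (q%:R * theta) <= distZ (p%:R * theta)].
Proof. exact: inf_posnat_le_min. Qed.

Lemma upsilon_min (R : realType) (theta t : R) : 1 <= t ->
  exists q, [/\ posnat_le t q, upsilon theta t = q%:R * distZ (q%:R * theta) &
    forall p, posnat_le t p ->
      q%:R * distZ (q%:R * theta) <= p%:R * distZ (p%:R * theta)].
Proof. exact: inf_posnat_le_min. Qed.

(* Main.v *)
(** Just before a new best approximation denominator one has
    [psi theta t >= 1 / (4 t)].  If [1 < g < 2] and [upsilon theta t <= K t^(1 - g)],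
    the minimiser [q] of [upsilon theta t] at such a scale has
    [e = distZ (q theta) >= 1 / (4 t)]; eliminating [t] from
    [q e <= K t^(1 - g)] gives [e <= K' q^(- 1 / (2 - g))].  Since
    [e <= K t^(1 - g)] tends to [0], these [q] are unbounded, whence
    [1 / (2 - g) <= omega theta].  The range [weak_omega theta <= 1] is covered
    by Dirichlet's bound [1 <= omega theta]. *)

Require Import Defs.
From HB Require Import structures.
From mathcomp Require Import all_boot all_order all_algebra.
From mathcomp Require Import all_classical all_reals all_analysis.
From mathcomp Require Import ring lra.
Import Order.TTheory GRing.Theory Num.Theory.
Import numFieldNormedType.Exports.
Local Open Scope classical_set_scope.
Local Open Scope ring_scope.

(** * Distance to the nearest integer and Dirichlet's theorem *)

Lemma distZ_le {R : realType} (x : R) (n : int) : distZ x <= `|x - n%:~R|.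
Proof. by have [m [-> ->]] := distZ_attained x. Qed.

Lemma distZ_gt0 {R : realType} (theta : R) (q : nat) :
  irrational theta -> (0 < q)%N -> 0 < distZ (q%:R * theta).
Proof.
move=> irr q0; have [n [-> _]] := distZ_attained (q%:R * theta).
rewrite normr_gt0 subr_eq0; apply/eqP => qn; apply: irr.
exists (n%:~R / q%:R) => //.
rewrite fmorph_div /= ratr_int ratr_nat -qn mulrAC mulfV ?mul1r//.
by rewrite pnatr_eq0 -lt0n.
Qed.

(** Pigeonhole: [u k] is [N] times the fractional part of [k theta], so the [N + 1] indices [k <= N]
    fall into [N] boxes [Num.truncn (u k)]. Two indices in one box differ by a suitable [q]. *)
Lemma dirichlet {R : realType} (theta : R) (N : nat) : (0 < N)%N ->
  exists q, (0 < q <= N)%N /\ N%:R * distZ (q%:R * theta) < 1.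
Proof.
move=> N0; have NR : 0 < N%:R :> R by rewrite ltr0n.
apply/not_existsP => noq.
pose u k : R := N%:R * (k%:R * theta - (Num.floor (k%:R * theta))%:~R).
have u_ge0 k : 0 <= u k by rewrite mulr_ge0 ?subr_ge0 ?floor_le_tmp ?ler0n.
have u_lt k : u k < N%:R.
  rewrite -[ltRHS]mulr1 ltr_pM2l// ltrBlDr addrC.
  by have := floorD1_gt (k%:R * theta); rewrite intrD.
have close i j : (i < j)%N -> (j <= N)%N ->
    Num.truncn (u i) <> Num.truncn (u j).
  move=> ij jN uij; apply: (noq (j - i)%N); rewrite subn_gt0 ij.
  rewrite (leq_trans (leq_subr _ _))//; split=> //.
  have /andP[i1 i2] := truncn_itv (u_ge0 i).
  have /andP[j1 j2] := truncn_itv (u_ge0 j).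
  apply: le_lt_trans (_ : `|u j - u i| < 1); last first.
    move: i1 i2 j1 j2; rewrite uij -natr1 ltr_norml => *.
    by apply/andP; split; lra.
  rewrite /u -mulrBr normrM gtr0_norm// ler_pM2l//.
  apply: le_trans
    (distZ_le _ (Num.floor (j%:R * theta) - Num.floor (i%:R * theta))) _.
  rewrite natrB ?(ltnW ij)// intrD mulrNz le_eqVlt; apply/orP; left.
  by apply/eqP; congr `|_|; ring.
have : (N.+1 <= N)%N; last by rewrite ltnn.
apply: (@pigeonhole _ _ (fun k => Num.truncn (u k))).
  move=> i j; rewrite !inE /= !ltnS => iN jN uij.
  by case: (ltngtP i j) => // h; [case: (close _ _ h jN)|case: (close _ _ h iN)].
by move=> _ [k _ <-] /=; rewrite truncn_lt_nat.
Qed.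

(** * Scales at which [psi] is large *)

Lemma psi_le {R : realType} (theta t : R) (q : nat) :
  posnat_le t q -> psi theta t <= distZ (q%:R * theta).
Proof.
move=> tq; have t1 : 1 <= t by case: tq => q0; apply: le_trans; rewrite ler1n.
by have [p [_ -> ->]] := psi_min theta t1.
Qed.

Lemma psi_gt0 {R : realType} (theta t : R) :
  irrational theta -> 1 <= t -> 0 < psi theta t.
Proof.
by move=> irr t1; have [p [[p0 _] -> _]] := psi_min theta t1; apply: distZ_gt0.
Qed.

(* If [q] is a best approximation and [1 <= p < q], the determinant of
   [(p, a)] and [(q, b)], with [a] and [b] the nearest integers to
   [p theta] and [q theta], is a nonzero integer. *)
Lemma record_distZ_ge {R : realType} (theta : R) (p q : nat) :
  (0 < p < q)%N -> distZ (q%:R * theta) < distZ (p%:R * theta) ->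
  1 <= 2 * q%:R * distZ (p%:R * theta).
Proof.
move=> /andP[p0 pq]; have [a [-> _]] := distZ_attained (p%:R * theta).
have [b [-> _]] := distZ_attained (q%:R * theta).
set ep := p%:R * theta - _; set eq := q%:R * theta - _ => lt_eq.
have eq_ge0 := normr_ge0 eq.
have pR : 0 < p%:R :> R by rewrite ltr0n.
have pqR : p%:R < q%:R :> R by rewrite ltr_nat.
have detE : (p%:Z * b - q%:Z * a)%:~R = q%:R * ep - p%:R * eq :> R.
  by rewrite rmorphB /= !rmorphM /= /ep /eq -!pmulrn; ring.
(* A zero determinant would give [q |ep| = p |eq|], impossible since [p < q] and [|eq| < |ep|]. *)
have [/eqP det0|det0] := eqVneq (p%:Z * b - q%:Z * a) 0.
  move: detE; rewrite (eqP det0) => /esym/eqP; rewrite subr_eq0 => /eqP.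
  move/(congr1 Num.norm); rewrite !normrM !normr_nat => E; nra.
have : 1 <= `|q%:R * ep - p%:R * eq|.
  by rewrite -detE -intr_norm ler1z -gtz0_ge1 normr_gt0.
move/le_trans/(_ (ler_normB _ _)); rewrite !normrM !normr_nat; nra.
Qed.

(** Take [t = q - 1], where [q] is the first denominator beating [psi theta m]. The minimiser [p] at
    [t] is less than [q], so the determinant bound applies, and [q <= 2 (q - 1)] turns its factor 2
    into 4. *)
Lemma psi_ge_often {R : realType} (theta M : R) : irrational theta ->
  exists t, [/\ 1 <= t, M <= t & 1 <= 4 * t * psi theta t].
Proof.
move=> irr; pose m := (Num.truncn M).+1.
have m1 : 1 <= m%:R :> R by rewrite ler1n.
have e0 : 0 < psi theta m%:R by exact: psi_gt0.
(* Dirichlet's theorem with [N > 1 / psi theta m] provides a denominator beating [psi theta m]. *)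
pose N := (Num.truncn (psi theta m%:R)^-1).+1.
have [q0 [/andP[q00 _] Nq0]] := dirichlet theta N isT.
have small : exists q, (0 < q)%N && (distZ (q%:R * theta) < psi theta m%:R).
  exists q0; rewrite q00 /=.
  have : (psi theta m%:R)^-1 < N%:R by exact: truncnS_gt.
  rewrite -(ltr_pM2r e0) mulVf ?gt_eqF// => h.
  have := lt_trans Nq0 h; by rewrite ltr_pM2l ?ltr0n.
case: (ex_minnP small) => q /andP[q_gt0 dq] minq.
have mq : (m < q)%N.
  rewrite ltnNge; apply/negP => qm; move: dq; rewrite ltNge psi_le//.
  by split; rewrite ?ler_nat.
have q1 : q.-1%:R = q%:R - 1 :> R by rewrite -subn1 natrB.
have q2 : 2 <= q%:R :> R by rewrite ler_nat; exact: leq_trans mq.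
have t1 : 1 <= q.-1%:R :> R by lra.
exists q.-1%:R; split=> //.
  apply: le_trans (ltW (truncnS_gt M)) _.
  by rewrite ler_nat -ltnS prednK.
have [p [[p0 pq] -> _]] := psi_min theta t1.
have {}pq : (p < q)%N by rewrite -(prednK q_gt0) ltnS -(ler_nat R).
have dp : distZ (q%:R * theta) < distZ (p%:R * theta).
  apply: lt_le_trans dq _; rewrite leNgt; apply/negP => h.
  by have := minq p; rewrite p0 h leqNgt pq => /(_ isT).
have := record_distZ_ge theta p q; rewrite p0 pq => /(_ isT dp).
have := distZ_gt0 theta p irr p0; rewrite q1; nra.
Qed.

(** * Finite limits at infinity as real bounds *)

Lemma limf_einf_pinfty_lty {R : realType} (f : R -> R) (K : R) :
  (forall M, exists2 t, M <= t & f t <= K) ->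
  (limf_einf (fun t => (f t)%:E) (pinfty_nbhs R) < +oo)%E.
Proof.
move=> fK; apply: le_lt_trans (ltry K); rewrite /limf_einf leeNl.
apply: le_ereal_inf_tmp => _ [V [M [_ MV]] <-].
(* A neighbourhood of [+oo] contains an open ray [t > M], hence the shift by 1. *)
have [t Mt ftK] := fK (M + 1).
apply: le_trans (_ : (_ <= - (f t)%:E)%E) _; first by rewrite leeN2 lee_fin.
by apply: ereal_sup_ubound; exists t => //; apply: MV; lra.
Qed.

Lemma limf_esup_pinfty_ltyP {R : realType} (f : R -> R) :
  (limf_esup (fun t => (f t)%:E) (pinfty_nbhs R) < +oo)%E <->
  exists K M, forall t, M <= t -> f t <= K.
Proof.
split=> [/ereal_inf_lt[_ [V [M [_ MV]] <-]] supV|[K [M fK]]].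
  have [K supVK] : exists K : R, (ereal_sup [set (f x)%:E | x in V] <= K%:E)%E.
    by case: (ereal_sup _) supV => [r||] // _; [exists r|exists 0; rewrite leNye].
  exists K, (M + 1) => t Mt; rewrite -lee_fin; apply: le_trans supVK.
  by apply: ereal_sup_ubound; exists t => //; apply: MV; lra.
apply: le_lt_trans (ltry K); apply: le_trans (_ : (_ <= ereal_sup
    [set (f x)%:E | x in [set t | (M <= t)%R]])%E) _.
  apply: ereal_inf_lbound; exists [set t | M <= t] => //.
  exact: (nbhs_pinfty_ge (num_real M)).
by apply: ge_ereal_sup => _ [t Mt <-]; rewrite lee_fin fK.
Qed.

(** * Admissible exponents *)

Lemma omega_ge1 {R : realType} (theta : R) : (1 <= omega theta)%E.
Proof.
apply: ereal_sup_ubound; exists 1 => //; apply: (limf_einf_pinfty_lty _ 1) => M.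
pose N := (Num.truncn M).+1.
exists N%:R; first exact/ltW/truncnS_gt.
have [q [/andP[q0 qN] /ltW Nq]] := dirichlet theta N isT.
rewrite powRr1 ?ler0n//; apply: le_trans Nq; rewrite ler_pM2l ?ltr0n//.
by apply: psi_le; split; rewrite ?ler_nat.
Qed.

Lemma upsilon_ge0 {R : realType} (theta t : R) : irrational theta -> 1 <= t ->
  0 <= upsilon theta t.
Proof.
move=> irr t1; have [q [[q0 _] -> _]] := upsilon_min theta t1.
by rewrite mulr_ge0// ltW// distZ_gt0.
Qed.

(** For [t >= 1] a smaller exponent gives a smaller power of [t], and [upsilon] is nonnegative. This
    later allows passing to an exponent strictly between 1 and 2. *)
Lemma weak_exponent_le {R : realType} (theta g h : R) : irrational theta ->
  g <= h ->
  (limf_esup (fun t => (t `^ (h - 1) * upsilon theta t)%:E) (pinfty_nbhs R)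
    < +oo)%E ->
  (limf_esup (fun t => (t `^ (g - 1) * upsilon theta t)%:E) (pinfty_nbhs R)
    < +oo)%E.
Proof.
move=> irr gh /limf_esup_pinfty_ltyP[K [M hK]].
apply/limf_esup_pinfty_ltyP; exists K, (Num.max M 1) => t.
rewrite ge_max => /andP[Mt t1]; apply: le_trans (hK t Mt).
by rewrite ler_wpM2r ?upsilon_ge0// ler_powR// lerD2r.
Qed.

(** * From the weak uniform exponent to the ordinary one *)

(** Multiplying by [(4 t e)^a >= 1] trades the scale [t] for a power of [e]. It serves with
    [a = g - 1] and [x = q]. *)
Lemma powR_eliminate_scale {R : realType} (a t e x K : R) :
  0 <= a -> 0 <= t -> 0 < e -> 0 <= x -> 1 <= 4 * t * e ->
  t `^ a * (x * e) <= K -> x * e `^ (1 - a) <= 4 `^ a * K.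
Proof.
move=> a0 t0 e0 x0 te xeK.
have t4 : 0 <= 4 * t by rewrite mulr_ge0.
have eE : e `^ a * e `^ (1 - a) = e.
  rewrite -powRD; last by apply/implyP => _; rewrite gt_eqF.
  by rewrite addrC subrK powRr1// ltW.
have tea : 1 <= 4 `^ a * t `^ a * e `^ a.
  rewrite -!powRM ?(ltW e0)//.
  apply: le_trans (_ : 1 `^ a <= _); first by rewrite powR1.
  by apply: ge0_ler_powR; rewrite ?nnegrE// mulr_ge0 ?(ltW e0).
apply: le_trans (_ : 4 `^ a * (t `^ a * (x * e)) <= _); last first.
  by rewrite ler_wpM2l ?powR_ge0.
have -> : 4 `^ a * (t `^ a * (x * e)) =
    (4 `^ a * t `^ a * e `^ a) * (x * e `^ (1 - a)).
  by rewrite -[in LHS]eE; move: (4 `^ a) (t `^ a) (e `^ a) => *; ring.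
by rewrite ler_peMl// mulr_ge0 ?powR_ge0.
Qed.

Lemma weak_exponent_omega {R : realType} (theta g : R) : irrational theta ->
  1 < g < 2 ->
  (limf_esup (fun t => (t `^ (g - 1) * upsilon theta t)%:E) (pinfty_nbhs R)
    < +oo)%E ->
  (((2 - g)^-1)%:E <= omega theta)%E.
Proof.
move=> irr /andP[g1 g2] /limf_esup_pinfty_ltyP[K [M0 upsK]].
apply: ereal_sup_ubound; exists (2 - g)^-1 => //.
have a0 : 0 < g - 1 by lra.
have s0 : 0 < 2 - g by lra.
(* The constant comes from raising [q e^(2 - g) <= 4^(g - 1) K] to the power [1 / (2 - g)]. *)
apply: (limf_einf_pinfty_lty _ ((4 `^ (g - 1) * K) `^ (2 - g)^-1)) => M.
pose M1 := Num.max M 1.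
have M11 : 1 <= M1 by rewrite le_max lexx orbT.
have psiM := psi_gt0 theta M1 irr M11.
(* Once [t^(g - 1) >= B], one has [t^(g - 1) psi theta M1 > K], which pushes the minimiser [q]
   beyond [M1]. The maximum with 0 lets [B] be recovered from its real power. *)
pose B := Num.max (K / psi theta M1 + 1) 0.
have [t [t1 + tpsi]] := psi_ge_often theta
  (Num.max M0 (B `^ (g - 1)^-1)) irr.
rewrite ge_max => /andP[M0t Bt].
have := upsK t M0t; have [q [[q0 qt] -> _]] := upsilon_min theta t1.
set e := distZ _ => qeK.
have e0 : 0 < e by exact: distZ_gt0.
have q1 : 1 <= q%:R :> R by rewrite ler1n.
have t0 : 0 < t by lra.
have te : 1 <= 4 * t * e.
  by apply: le_trans tpsi _; rewrite ler_pM2l; [exact: psi_le|lra].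
have Bta : B <= t `^ (g - 1).
  have B0 : 0 <= B by rewrite le_max lexx orbT.
  have -> : B = (B `^ (g - 1)^-1) `^ (g - 1).
    by rewrite -powRrM mulVf ?lt0r_neq0// powRr1.
  by rewrite ge0_ler_powR ?nnegrE ?powR_ge0 ?(ltW t0) ?(ltW a0).
have M1q : M1 < q%:R.
  rewrite ltNge; apply/negP => qM1.
  have psie : psi theta M1 <= e by apply: psi_le.
  have KB : K < t `^ (g - 1) * psi theta M1.
    rewrite -ltr_pdivrMr//; apply: lt_le_trans Bta.
    by rewrite lt_max; apply/orP; left; lra.
  suff : t `^ (g - 1) * psi theta M1 <= K by rewrite leNgt KB.
  apply: le_trans qeK; rewrite ler_wpM2l ?powR_ge0//; nra.
(* The lower limit is tested at [q] itself rather than at the scale [t], using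
   [psi theta q <= e]. *)
exists q%:R; first by apply: le_trans (ltW M1q); rewrite le_max lexx.
apply: le_trans (_ : q%:R `^ (2 - g)^-1 * e <= _).
  by rewrite ler_wpM2l ?powR_ge0// psi_le//; split.
have -> : q%:R `^ (2 - g)^-1 * e = (q%:R * e `^ (2 - g)) `^ (2 - g)^-1.
  rewrite powRM ?powR_ge0 ?ler0n// -powRrM mulfV ?lt0r_neq0//.
  by rewrite powRr1// ltW.
have main : q%:R * e `^ (2 - g) <= 4 `^ (g - 1) * K.
  rewrite (_ : 2 - g = 1 - (g - 1)); last by ring.
  by apply: powR_eliminate_scale te qeK; rewrite ?(ltW a0) ?(ltW t0).
have lhs0 : 0 <= q%:R * e `^ (2 - g) by rewrite mulr_ge0 ?powR_ge0.
by rewrite ge0_ler_powR ?nnegrE ?invr_ge0 ?(ltW s0)// (le_trans lhs0).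
Qed.

(** * Comparison of the two exponents *)

(** Solving for the weak exponent leaves only the inverse of the real number [o >= 1], so the case
    [1 / 0] does not arise. *)
Lemma weak_omega_le {R : realType} (theta o : R) : irrational theta ->
  omega theta = o%:E -> (weak_omega theta <= (2 - o^-1)%:E)%E.
Proof.
move=> irr oE; have o1 : 1 <= o by rewrite -lee_fin -oE omega_ge1.
have o0 : 0 < o by lra.
have oV0 : 0 < o^-1 by rewrite invr_gt0.
have oV1 : o^-1 <= 1 by rewrite invf_le1.
apply: ge_ereal_sup => _ [h hweak <-]; rewrite lee_fin leNgt; apply/negP => oh.
(* The midpoint of [2 - 1/o] and [min(h, 2)] lies strictly between 1 and 2 because [o >= 1], even if
   [h] exceeds 2. It still exceeds [2 - 1/o], contradicting [1 / (2 - g) <= o]. *)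
pose g := (2 - o^-1 + Num.min h 2) / 2.
have [minh min2] : Num.min h 2 <= h /\ Num.min h 2 <= 2.
  by rewrite !ge_min !lexx orbT.
have omin : 2 - o^-1 < Num.min h 2 by rewrite lt_min oh; lra.
have g12 : 1 < g < 2 by apply/andP; rewrite /g; split; lra.
have gh : g <= h by rewrite /g; lra.
have := weak_exponent_omega theta g irr g12 (weak_exponent_le theta g h irr gh hweak).
rewrite oE lee_fin invf_ple ?posrE//; last by lra.
by apply/negP; rewrite -ltNge /g; lra.
Qed.

Theorem theorem1 (R : realType) (theta : R) (htheta : irrational theta) :
  ((2%:E - weak_omega theta)^-1 <= omega theta)%E /\
  (weak_omega theta = 2%:E -> omega theta = +oo%E).
Proof.
have := weak_omega_le theta ^~ htheta; have := omega_ge1 theta.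
case: (omega theta) => [ o o1 /(_ _ erefl) wo|_ _|]//; last by rewrite leey.
have o0 : 0 < o by rewrite (lt_le_trans ltr01)// -lee_fin.
have oV0 : 0 < o^-1 by rewrite invr_gt0.
(* For finite [o] the weak exponent is at most [2 - 1/o < 2], so it cannot equal 2. *)
split; last by move=> w2; move: wo; rewrite w2 lee_fin leNgt ltrBlDr ltrDl oV0.
(* Only an upper bound on [weak_omega theta] is at hand, so the value [-oo] is treated too: the
   difference is then [+oo]. *)
have le_inv : ((o^-1)%:E <= 2%:E - weak_omega theta)%E.
  case: (weak_omega theta) wo => [w||]//; last by rewrite leey.
  rewrite -EFinB !lee_fin => wo; lra.
rewrite inve_ple ?inE//= ?lee_fin ?(ltW o0)//.
by rewrite inver gt_eqF.
by apply: le_trans le_inv; rewrite lee_fin ltW.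
Qed.
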